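(* Let $\mathbf{y}\in C^2([0,T];\mathbb{R}^{N_h})$ be the solution of the Cauchy problem $\mathbf{y}'(t)=\mathbf{f}(t,\mathbf{y}(t))$ for all $t\in I=(0,T]$, $\mathbf{y}(0)=\mathbf{y}_0$, and suppose that $\mathbf{f}$ is Lipschitz continuous in its second argument with Lipschitz constant $L>0$. Then the IMEX--RB method is convergent of order 1: there exists a constant $C>0$, independent of $\Delta t$ and $n$, such that every IMEX--RB approximation $\{\mathbf{u}_n\}_{n=0}^{N_t}$ with timestep $\Delta t$ satisfies $$\|\mathbf{e}_{n+1}\| := \|\mathbf{y}(t_{n+1})-\mathbf{u}_{n+1}\| < C\,\Delta t, \qquad n=0,\dots,N_t-1.$$
   Context: Let $T>0$, $N_h\in\mathbb{N}$, $\mathbf{y}_0\in\mathbb{R}^{N_h}$, and let $\mathbf{f}: I\times\mathbb{R}^{N_h}\to\mathbb{R}^{N_h}$ be bounded and continuous in both arguments (standing assumptions). For $N_t\in\mathbb{N}$ set $\Delta t=T/N_t$ and $t_n=n\Delta t$. $\|\cdot\|$ is the Euclidean norm. An IMEX--RB approximation with timestep $\Delta t$ is a sequence $\{\mathbf{u}_n\}_{n=0}^{N_t}\subset\mathbb{R}^{N_h}$ with $\mathbf{u}_0=\mathbf{y}_0$ such that, for $n=0,\dots,N_t-1$, there is a real matrix $\mathbf{V}_n$ with $N_h$ rows and orthonormal columns (the number $N$ of columns may depend on $n$), whose column space contains $\mathbf{u}_n$, and a vector $\boldsymbol{\delta u}^N_{n+1}\in\mathbb{R}^N$ with $$\boldsymbol{\delta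 u}^N_{n+1} = \Delta t\, \mathbf{V}_n^{T} \mathbf{f}\bigl(t_{n+1}, \mathbf{V}_n \boldsymbol{\delta u}^N_{n+1} + \mathbf{u}_n\bigr), \qquad \mathbf{u}_{n+1} = \mathbf{u}_n + \Delta t\, \mathbf{f}\bigl(t_{n+1}, \mathbf{V}_n \boldsymbol{\delta u}^N_{n+1} + \mathbf{u}_{n}\bigr).$$ Equivalently, $\mathbf{u}_{n+1}=\mathbf{u}_n+\Delta t\,\mathbf{f}(t_{n+1},\mathbf{V}_n\mathbf{V}_n^{T}\mathbf{u}_{n+1})$. *)

(* Defs.v *)
From mathcomp Require Export all_boot all_order all_algebra.
From mathcomp Require Export all_classical all_reals all_analysis.

Set Implicit Arguments.
Unset Strict Implicit.
Unset Printing Implicit Defensive.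

Import Order.TTheory GRing.Theory Num.Theory.
Import numFieldNormedType.Exports.

Local Open Scope classical_set_scope.
Local Open Scope ring_scope.

(* The library norm `|x| on matrices is the max norm, hence this definition. *)
Definition enorm (R : realType) (d : nat) (x : 'cV[R]_d) : R :=
  Num.sqrt (\sum_(i < d) x i 0 ^+ 2).

(* Derivative relative to D: the limit of the difference quotient is taken
   along s in D only, so it is one-sided at an endpoint of an interval D. *)
Definition has_derivative_in (R : realType) (d : nat) (D : set R)
    (y : R -> 'cV[R]_d) (t : R) (v : 'cV[R]_d) : Prop :=
  (s - t)^-1 *: (y s - y t) @[s --> within D t^'] --> v.

Definition C2_on (R : realType) (d : nat) (D : set R) (y : R -> 'cV[R]_d) :
    Prop :=
  exists y1 y2 : R -> 'cV[R]_d,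
    [/\ forall t, D t -> has_derivative_in D y t (y1 t),
        forall t, D t -> has_derivative_in D y1 t (y2 t)
      & {within D, continuous y2}].

Definition timestep (R : realType) (T : R) (Nt : nat) : R := T / Nt%:R.

Definition gridpoint (R : realType) (T : R) (Nt n : nat) : R :=
  n%:R * timestep T Nt.

(* One step of size dt from u to u', with implicit time level t. The condition
   (u^T <= V^T)%MS says that the column space of V contains u. *)
Definition imex_rb_step (R : realType) (Nh : nat)
    (f : R -> 'cV[R]_Nh -> 'cV[R]_Nh) (dt t : R) (u u' : 'cV[R]_Nh) : Prop :=
  exists (N : nat) (V : 'M[R]_(Nh, N)) (du : 'cV[R]_N),
    [/\ V^T *m V = 1%:M,
        (u^T <= V^T)%MS,
        du = dt *: (V^T *m f t (V *m du + u))
      & u' = u + dt *: f t (V *m du + u)].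

(* Only the values u 0, ..., u Nt are constrained. *)
Definition imex_rb_approximation (R : realType) (Nh : nat) (T : R)
    (f : R -> 'cV[R]_Nh -> 'cV[R]_Nh) (y0 : 'cV[R]_Nh) (Nt : nat)
    (u : nat -> 'cV[R]_Nh) : Prop :=
  u 0%N = y0 /\
  forall n : nat, (n < Nt)%N ->
    imex_rb_step f (timestep T Nt) (gridpoint T Nt n.+1) (u n) (u n.+1).

(* Main.v *)
Require Import Defs.
From mathcomp Require Import ring lra.

(** The method is an implicit Euler step in which [f] is evaluated not at
    [u_(n+1)] but at [w = u_n + V (V^T (u_(n+1) - u_n))]. Since [V V^T] is an
    orthogonal projection and [f] is bounded by [M], [w] stays within [dt M] of
    [u_n], whatever the reduced basis [V] is. The exact solution also moves by
    [O(dt)] over one step, so [|y(t_(n+1)) - w| <= |e_n| + O(dt)], and the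
    Lipschitz condition turns this into an [O(dt^2)] perturbation per step:
    [|e_(n+1)| <= (1 + dt L) |e_n| + O(dt^2)] (lemma [imex_rb_step_error]).

    The other [O(dt^2)] contribution is the defect
    [y(t_(n+1)) - y(t_n) - dt y'(t_(n+1))] of the exact solution, estimated by
    [backward_taylor] because [y] is of class C^2 on a compact interval. As
    [n dt <= T], [discrete_gronwall] sums these contributions into a bound
    [T B exp(T L) dt], with [B] depending only on [T], [L], [M] and [y]. *)

Set Implicit Arguments.
Unset Strict Implicit.
Unset Printing Implicit Defensive.

Import Order.TTheory GRing.Theory Num.Theory.
Import numFieldNormedType.Exports.

Local Open Scope classical_set_scope.
Local Open Scope ring_scope.

(** * Euclidean norm *)

Lemma enorm_ge0 (R : realType) (d : nat) (x : 'cV[R]_d) : 0 <= enorm x.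
Proof. exact: sqrtr_ge0. Qed.

Lemma sqr_enorm (R : realType) (d : nat) (x : 'cV[R]_d) :
  enorm x ^+ 2 = \sum_(i < d) x i 0 ^+ 2.
Proof. by rewrite sqr_sqrtr // sumr_ge0 // => i _; exact: sqr_ge0. Qed.

Lemma enorm0_eq0 (R : realType) (d : nat) (x : 'cV[R]_d) :
  enorm x = 0 -> x = 0.
Proof.
move=> x0; have /eqP := sqr_enorm x.
rewrite x0 expr0n /= eq_sym psumr_eq0 => [/allP xi0|i _]; last exact: sqr_ge0.
apply/matrixP => i j; rewrite ord1 mxE.
by have := xi0 i; rewrite mem_index_enum sqrf_eq0 => /(_ isT)/eqP.
Qed.

(** One-sided Cauchy-Schwarz inequality: expanding the squares
    [(b x_i - a z_i) ^ 2 >= 0] with [a], [b] the norms of [x], [z] and summing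
    over [i] bounds [2 a b <x, z>] by [2 a^2 b^2]. *)
Lemma dot_le_enorm (R : realType) (d : nat) (x z : 'cV[R]_d) :
  \sum_(i < d) x i 0 * z i 0 <= enorm x * enorm z.
Proof.
have [x0|nx0] := eqVneq (enorm x) 0.
  rewrite x0 mul0r (enorm0_eq0 x0) big1 // => i _.
  by rewrite mxE mul0r.
have [z0|nz0] := eqVneq (enorm z) 0.
  rewrite z0 mulr0 (enorm0_eq0 z0) big1 // => i _.
  by rewrite mxE mulr0.
set a := enorm x; set b := enorm z.
have ab_gt0 : 0 < a * b *+ 2.
  by rewrite mulrn_wgt0 // mulr_gt0 // lt0r enorm_ge0 andbT.
rewrite -(ler_pM2l ab_gt0) mulr_sumr.
apply: (@le_trans _ _ (\sum_(i < d) (b ^+ 2 * x i 0 ^+ 2 + a ^+ 2 * z i 0 ^+ 2))).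
  by apply: ler_sum => i _; have := sqr_ge0 (b * x i 0 - a * z i 0); nra.
by rewrite big_split /= -!mulr_sumr -!sqr_enorm -/a -/b; lra.
Qed.

Lemma ler_enormD (R : realType) (d : nat) (x z : 'cV[R]_d) :
  enorm (x + z) <= enorm x + enorm z.
Proof.
rewrite -ler_sqr ?nnegrE ?addr_ge0 ?enorm_ge0 //.
rewrite sqrrD !sqr_enorm.
under eq_bigr do rewrite mxE sqrrD.
rewrite !big_split /= lerD2r lerD2l.
by rewrite -mulr2n ler_pMn2r // dot_le_enorm.
Qed.

Lemma enormZ (R : realType) (d : nat) (a : R) (x : 'cV[R]_d) :
  0 <= a -> enorm (a *: x) = a * enorm x.
Proof.
move=> a0; rewrite /enorm; under eq_bigr do rewrite mxE exprMn.
by rewrite -mulr_sumr sqrtrM ?sqr_ge0 // sqrtr_sqr ger0_norm.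
Qed.

Lemma enormN (R : realType) (d : nat) (x : 'cV[R]_d) : enorm (- x) = enorm x.
Proof. by rewrite /enorm; under eq_bigr do rewrite mxE sqrrN. Qed.

(** Turns coordinatewise estimates into an estimate of the Euclidean norm. *)
Lemma enorm_le_sum (R : realType) (d : nat) (x : 'cV[R]_d) :
  enorm x <= \sum_(i < d) `|x i 0|.
Proof.
rewrite -ler_sqr ?nnegrE ?enorm_ge0 ?sumr_ge0 // sqr_enorm.
suff [] : 0 <= \sum_(i < d) `|x i 0| /\
  \sum_(i < d) x i 0 ^+ 2 <= (\sum_(i < d) `|x i 0|) ^+ 2 by [].
elim/big_ind2 : _ => [|a p b q [p0 ap] [q0 bq]|i _].
- by rewrite expr0n.
- by split; [exact: addr_ge0 | nra].
- by rewrite normr_ge0 real_normK ?num_real.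
Qed.

(** [P = V V^T] is an orthogonal projection, so [|P x|^2 = <x, P x>], and
    Cauchy-Schwarz cancels one factor [|P x|]. *)
Lemma enorm_proj_le (R : realType) (d N : nat) (V : 'M[R]_(d, N))
    (x : 'cV[R]_d) :
  V^T *m V = 1%:M -> enorm (V *m (V^T *m x)) <= enorm x.
Proof.
move=> VV; set p := V *m _.
have dotE (a b : 'cV[R]_d) : \sum_(i < d) a i 0 * b i 0 = (a^T *m b) 0 0.
  by rewrite mxE; apply: eq_bigr => i _; rewrite mxE.
have pp : enorm p ^+ 2 = \sum_(i < d) x i 0 * p i 0.
  rewrite sqr_enorm; under eq_bigr do rewrite expr2.
  by rewrite !dotE /p !trmx_mul trmxK -!mulmxA (mulmxA V^T V) VV mul1mx.
have := dot_le_enorm x p; rewrite -pp expr2.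
have [->|p0] := eqVneq (enorm p) 0; first by rewrite enorm_ge0.
by rewrite ler_pM2r // lt0r p0 enorm_ge0.
Qed.

(** * Derivatives relative to an interval *)

Lemma has_derivative_in_coord (R : realType) (d : nat) (D : set R)
    (y : R -> 'cV[R]_d) (t : R) (v : 'cV[R]_d) (i : 'I_d) :
  has_derivative_in D y t v ->
  (s - t)^-1 * (y s i 0 - y t i 0) @[s --> within D t^'] --> v i 0.
Proof.
move=> yv; have := continuous_cvg _ (@coord_continuous _ _ _ i 0 v) yv.
by rewrite /comp; under eq_fun do rewrite !mxE; apply.
Qed.

(** Near [t] the increment [y s - y t] is [s - t] times a convergent difference
    quotient. *)
Lemma has_derivative_in_continuous (R : realType) (d : nat) (D : set R)
    (y v : R -> 'cV[R]_d) (i : 'I_d) :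
  (forall t, D t -> has_derivative_in D y t (v t)) ->
  {within D, continuous (fun t => y t i 0)}.
Proof.
move=> yv; apply/subspace_continuousP => /= t Dt; move: (t : R) Dt => {}t Dt.
have /= qv := has_derivative_in_coord (i := i) (yv t Dt).
have st : s - t @[s --> within D t^'] --> (0 : R).
  have : s - t @[s --> t^'] --> t - t.
    apply: (@cvgB _ _ _ _ _ id (cst t)); last exact: cvg_cst.
    exact: cvg_within.
  by rewrite subrr; exact: cvg_within_filter.
have yt : y s i 0 @[s --> within D t^'] --> y t i 0.
  have -> : y t i 0 = y t i 0 + 0 * v t i 0 by rewrite mul0r addr0.
  apply: cvg_trans (cvgD (cvg_cst (y t i 0)) (cvgM st qv)).
  apply: near_eq_cvg.
  rewrite !near_withinE; near=> s => /= nst Ds.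
  have ? : s - t != 0 by rewrite subr_eq0.
  by rewrite [LHS](_ : _ = y t i 0 + (s - t) * ((s - t)^-1 * (y s i 0 - y t i 0))) // mulVKf // addrC subrK.
(* The limit above leaves out [s = t], where membership is trivial. *)
move=> A nA; change (\forall s \near t, D s -> A (y s i 0)).
have : \forall s \near t, s != t -> D s -> A (y s i 0) by exact: yt _ nA.
apply: filterS => s sA Ds.
by have [->|] := eqVneq s t; [exact: nbhs_singleton | move=> /sA; exact].
Unshelve. all: by end_near.
Qed.

(** The mean value theorem fails for vectors, hence the statement for one
    coordinate; the point [c] depends on that coordinate. The derivative
    relative to [D] is an ordinary one at [c] since [c] is interior. *)
Lemma coord_mean_value (R : realType) (d : nat) (D : set R)
    (y v : R -> 'cV[R]_d) (i : 'I_d) (a b : R) :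
  (forall t, D t -> has_derivative_in D y t (v t)) ->
  `[a, b] `<=` D -> a < b ->
  exists2 c, c \in `]a, b[ & y b i 0 - y a i 0 = v c i 0 * (b - a).
Proof.
move=> yv abD ab.
apply: (MVT (f := fun t => y t i 0) (df := fun t => v t i 0)) => //.
- move=> c cab.
  have cD : forall s, s \in `]a, b[ -> D s.
    by move=> s sab; apply: abD; exact: subset_itv_oo_cc.
  have qv := has_derivative_in_coord (i := i) (yv c (cD c cab)).
  have shiftc : h + c @[h --> (0:R)^'] --> within D c^'.
    move=> A; rewrite /within /= => nA.
    have nab : \forall s \near c, s \in `]a, b[ by exact: near_in_itvoo.
    have : \forall s \near c, s != c -> A s.
      near=> s => sc; have : D s by apply: cD; near: s.
      by move: sc; near: s.
    move=> /nbhs0P nA0; change (\forall h \near (0 : R)^', A (h + c)).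
    rewrite near_withinE; near=> h => h0; rewrite addrC.
    by have : c + h != c -> A (c + h) by [near: h]; apply; rewrite -subr_eq0 addrAC subrr add0r.
  have := cvg_comp _ _ shiftc qv.
  rewrite (_ : _ \o _ = fun h => h^-1 *: (((fun t => y t i 0) \o shift c) (h *: 1) - y c i 0)); last first.
    by apply/funext => h /=; rewrite addrK /GRing.scale /= mulr1.
  move=> dv; split; first by apply/cvg_ex; exists (v c i 0).
  exact: cvg_lim dv.
- exact: continuous_subspaceW abD (has_derivative_in_continuous (i := i) yv).
Unshelve. all: end_near.
Qed.

(** Identifies the derivative in the C^2 hypothesis with the right-hand side of
    the differential equation. The point [t] is not the left endpoint, so the
    limit can be tested along [s < t], including at [t = b]. *)
Lemma has_derivative_in_unique (R : realType) (d : nat) (a b : R)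
    (y : R -> 'cV[R]_d) (t : R) (v w : 'cV[R]_d) :
  a < t <= b -> has_derivative_in `[a, b] y t v ->
  has_derivative_in `[a, b] y t w -> v = w.
Proof.
move=> /andP[aT tb] yv yw.
have left_within : t^'- `=>` within `[a, b] t^'.
  move=> A nA; change (\forall s \near t, s < t -> A s).
  have : \forall s \near t, s != t -> `[a, b]%classic s -> A s by exact: nA.
  move=> nA'; near=> s => st.
  have : s != t by rewrite lt_eqF.
  have : `[a, b]%classic s.
    rewrite /= in_itv /= (ltW (lt_le_trans st tb)) andbT ltW //.
    by near: s; exact: lt_nbhsr.
  by near: s; apply: filterS nA' => s nAs ? ?; exact: nAs.
apply/matrixP => i j; rewrite ord1.
have lim_left u : has_derivative_in `[a, b] y t u ->
    (s - t)^-1 * (y s i 0 - y t i 0) @[s --> t^'-] --> u i 0.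
  move=> /(has_derivative_in_coord (i := i)); apply: cvg_trans.
  exact: cvg_app.
exact: cvg_unique (lim_left _ yv) (lim_left _ yw).
Unshelve. all: by end_near.
Qed.

(** Consistency of the implicit Euler quadrature. In each coordinate two uses of
    the mean value theorem write the defect as [- (t - s) (t - c) y2_i(e)] with
    [s < c < e < t]; as [y2_i] is bounded on the compact interval, summing the
    coordinates gives the constant. *)
Lemma backward_taylor (R : realType) (d : nat) (a b : R)
    (y y1 y2 : R -> 'cV[R]_d) :
  (forall t, `[a, b]%classic t -> has_derivative_in `[a, b] y t (y1 t)) ->
  (forall t, `[a, b]%classic t -> has_derivative_in `[a, b] y1 t (y2 t)) ->
  {within `[a, b], continuous y2} ->
  exists2 K, 0 <= K & forall s t, a <= s -> s < t -> t <= b ->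
    enorm (y t - y s - (t - s) *: y1 t) <= K * (t - s) ^+ 2.
Proof.
move=> yy1 y1y2 cy2.
have [ab|ba] := leP a b; last first.
  exists 0 => // s t sa st tb.
  by have := lt_le_trans ba (le_trans sa (le_trans (ltW st) tb)); rewrite ltxx.
have bound i : exists k : R, forall t, t \in `[a, b] -> `|y2 t i 0| <= k.
  have cy2i : {within `[a, b], continuous (fun t => `|y2 t i 0|)}.
    move=> t; apply: (@continuous_comp _ _ _ (y2 : subspace `[a, b] -> _)
      (fun M : 'cV[R]_d => `|M i 0|)) => //; first exact: cy2.
    apply: (@continuous_comp _ _ _ (fun M : 'cV[R]_d => M i 0) Num.norm).
      exact: coord_continuous.
    exact: norm_continuous.
  by have [c _ cmax] := EVT_max ab cy2i; exists `|y2 c i 0|.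
have [k kP] := fin_all_exists bound.
have a_ab : a \in `[a, b] by rewrite in_itv /= lexx.
exists (\sum_i k i).
  by apply: sumr_ge0 => i _; exact: le_trans (normr_ge0 _) (kP i _ a_ab).
move=> s t sa st tb; apply: le_trans (enorm_le_sum _) _.
rewrite mulr_suml; apply: ler_sum => i _; rewrite !mxE.
have sub r : s <= r -> r < t -> `[r, t] `<=` `[a, b].
  move=> sr rt x /=; rewrite !in_itv /= => /andP[rx xt].
  by rewrite (le_trans sa (le_trans sr rx)) (le_trans xt tb).
have [c] := coord_mean_value i yy1 (sub s (lexx s) st) st.
rewrite in_itv /= => /andP[sc ct] ->.
have [e] := coord_mean_value i y1y2 (sub c (ltW sc) ct) ct.
rewrite in_itv /= => /andP[ce et] y1E.
have -> : y1 c i 0 * (t - s) - (t - s) * y1 t i 0 =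
    - ((t - s) * (t - c) * y2 e i 0).
  have -> : y1 t i 0 = y1 c i 0 + y2 e i 0 * (t - c) by rewrite -y1E; ring.
  ring.
have ke : `|y2 e i 0| <= k i.
  by apply: kP; rewrite in_itv /=; apply/andP; split; lra.
have ts : 0 <= t - s by lra.
have tc : 0 <= t - c by lra.
rewrite normrN !normrM (ger0_norm ts) (ger0_norm tc) mulrC.
apply: ler_pM; rewrite ?mulr_ge0 //.
by rewrite expr2 ler_wpM2l //; lra.
Qed.

(** * Error propagation *)

(** Each step multiplies earlier contributions by at most [exp a] and adds
    [b]. *)
Lemma discrete_gronwall (R : realType) (a b : R) (e : nat -> R) (m : nat) :
  0 <= a -> 0 <= b -> e 0%N <= 0 ->
  (forall n, (n < m)%N -> e n.+1 <= (1 + a) * e n + b) ->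
  forall n, (n <= m)%N -> e n <= n%:R * b * expR (n%:R * a).
Proof.
move=> a0 b0 e0 eS; elim=> [|n IH] nm; first by rewrite !mul0r.
have {}IH := IH (ltnW nm).
have E : 0 < expR (n%:R * a) by exact: expR_gt0.
have E1 : 1 + a <= expR a by exact: expR_ge1Dx.
have E2 : 1 <= expR (n.+1%:R * a) by rewrite (le_trans _ (expR_ge1Dx _)) // lerDl mulr_ge0.
apply: (le_trans (eS n nm)).
rewrite -[in n.+1%:R * b]natr1 (mulrDl n%:R) mul1r [leRHS]mulrDl.
apply: lerD; last by rewrite ler_peMr.
rewrite (_ : expR (n.+1%:R * a) = expR a * expR (n%:R * a)); last first.
  by rewrite -expRD -natr1; congr expR; ring.
rewrite mulrCA (le_trans (ler_wpM2l _ IH)) ?addr_ge0 //.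
by rewrite ler_wpM2r // !mulr_ge0 // ltW.
Qed.

(** The point [w = V du + u] where [f] is evaluated is [u] plus [dt] times a
    projection of [f t w], hence lies within [dt M] of [u] for every reduced
    basis; so does [x'] from [x], up to the defect [k]. Thus [x' - w] is
    controlled by the old error [x - u], not by the new one, and no inequality
    has to be solved for [x' - u']: this is why [dt] needs no smallness
    condition. *)
Lemma imex_rb_step_error (R : realType) (d : nat)
    (f : R -> 'cV[R]_d -> 'cV[R]_d) (L M dt t k : R) (u u' x x' : 'cV[R]_d) :
  0 <= L -> 0 <= dt ->
  (forall z w, enorm (f t z - f t w) <= L * enorm (z - w)) ->
  (forall z, enorm (f t z) <= M) ->
  imex_rb_step f dt t u u' ->
  enorm (x' - x - dt *: f t x') <= k ->
  enorm (x' - u') <=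
    (1 + dt * L) * enorm (x - u) + (k + dt * L * (k + dt * M *+ 2)).
Proof.
move=> L0 dt0 lip bnd [N [V [du [VV _ duE u'E]]]] defect.
set w := V *m du + u in duE u'E.
have wu : enorm (w - u) <= dt * M.
  rewrite /w addrK duE -scalemxAr enormZ // ler_wpM2l //.
  exact: le_trans (enorm_proj_le _ VV) (bnd w).
have xw : enorm (x' - w) <= enorm (x - u) + k + dt * M *+ 2.
  have -> : x' - w =
      (x - u) + (x' - x - dt *: f t x') + (dt *: f t x' - (w - u)).
    by apply/matrixP => i j; rewrite !mxE; ring.
  apply: le_trans (ler_enormD _ _) _; rewrite mulr2n; apply: lerD.
    by apply: le_trans (ler_enormD _ _) _; rewrite lerD2l.
  apply: le_trans (ler_enormD _ _) _; rewrite enormN; apply: lerD => //.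
  by rewrite enormZ // ler_wpM2l.
have -> : x' - u' =
    (x - u) + (x' - x - dt *: f t x') + dt *: (f t x' - f t w).
  by rewrite u'E; apply/matrixP => i j; rewrite !mxE; ring.
apply: le_trans (ler_enormD _ _) _.
have -> : (1 + dt * L) * enorm (x - u) + (k + dt * L * (k + dt * M *+ 2)) =
    enorm (x - u) + k + dt * (L * (enorm (x - u) + k + dt * M *+ 2)) by ring.
apply: lerD.
  by apply: le_trans (ler_enormD _ _) _; rewrite lerD2l.
rewrite enormZ // ler_wpM2l //; apply: le_trans (lip _ _) _.
by rewrite ler_wpM2l.
Qed.

Theorem theorem2p3 (R : realType) (T : R) (Nh : nat) (y0 : 'cV[R]_Nh)
    (f : R -> 'cV[R]_Nh -> 'cV[R]_Nh) (y : R -> 'cV[R]_Nh) (L : R)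
    (T_gt0 : 0 < T)
    (Nh_gt0 : (0 < Nh)%N)
    (f_bounded : exists M : R,
      forall t x, `]0, T]%classic t -> enorm (f t x) <= M)
    (f_continuous :
      {within `]0, T]%classic `*` [set: 'cV[R]_Nh],
        continuous (fun p : R * 'cV[R]_Nh => f p.1 p.2)})
    (y_C2 : C2_on `[0, T]%classic y)
    (y_ode : forall t, `]0, T]%classic t ->
      has_derivative_in `[0, T]%classic y t (f t (y t)))
    (y_init : y 0 = y0)
    (L_gt0 : 0 < L)
    (f_lipschitz : forall t x z, `]0, T]%classic t ->
      enorm (f t x - f t z) <= L * enorm (x - z)) :
  exists C : R, 0 < C /\
    forall Nt : nat, (0 < Nt)%N ->
    forall u : nat -> 'cV[R]_Nh, imex_rb_approximation T f y0 Nt u ->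
    forall n : nat, (n < Nt)%N ->
      enorm (y (gridpoint T Nt n.+1) - u n.+1) < C * timestep T Nt.
Proof.
have T_ge0 := ltW T_gt0.
have [M f_le_M] := f_bounded.
have M_ge0 : 0 <= M.
  apply: le_trans (enorm_ge0 _) (f_le_M T 0 _).
  by rewrite /= in_itv /= T_gt0 lexx.
have [y1 [y2 [yy1 y1y2 y2c]]] := y_C2.
have [K K_ge0 taylor] := backward_taylor yy1 y1y2 y2c.
have y1E t : 0 < t <= T -> y1 t = f t (y t).
  move=> t0T; apply: (has_derivative_in_unique t0T); last exact: y_ode.
  apply: yy1; rewrite /= in_itv /=.
  by case/andP: t0T => /ltW -> ->.
(* [B dt^2] bounds the new contribution of a step of size [dt <= T]: the defect
   is [k = K dt^2], and [dt L (k + 2 dt M)] is at most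
   [dt^2 L (K T + 2 M)]. *)
pose B := K + L * (K * T + M *+ 2).
have B_ge0 : 0 <= B.
  by rewrite addr_ge0 // mulr_ge0 ?addr_ge0 ?mulr_ge0 ?mulrn_wge0 // ltW.
(* The summand 1 makes the final inequality strict. *)
exists (T * B * expR (T * L) + 1); split.
  by rewrite ltr_wpDl // !mulr_ge0 ?expR_ge0 // ltW.
move=> Nt Nt_gt0 u [u0 u_step] n nNt.
have NtR : 0 < Nt%:R :> R by rewrite ltr0n.
set dt := timestep T Nt in u_step *.
have dt_gt0 : 0 < dt by rewrite divr_gt0.
have [dt_ge0 L_ge0] := (ltW dt_gt0, ltW L_gt0).
have grid_le m : (m <= Nt)%N -> m%:R * dt <= T.
  move=> mNt; rewrite /dt /timestep mulrA ler_pdivrMr // mulrC.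
  by rewrite ler_pM2l // ler_nat.
have dt_le : dt <= T by have := grid_le 1%N Nt_gt0; rewrite mul1r.
pose e m := enorm (y (gridpoint T Nt m) - u m).
have e0 : e 0%N <= 0.
  rewrite /e /gridpoint mul0r y_init u0 subrr /enorm big1 ?sqrtr0 // => i _.
  by rewrite mxE expr0n.
have eS m : (m < Nt)%N -> e m.+1 <= (1 + dt * L) * e m + B * dt ^+ 2.
  move=> mNt; rewrite /e.
  have tS : gridpoint T Nt m.+1 - gridpoint T Nt m = dt.
    by rewrite /gridpoint -/dt -natr1; ring.
  have tm0 : 0 <= gridpoint T Nt m by rewrite mulr_ge0 // ltW.
  have tS0 : 0 < gridpoint T Nt m.+1 <= T.
    by rewrite grid_le // andbT mulr_gt0.
  have tSin : `]0, T]%classic (gridpoint T Nt m.+1) by rewrite /= in_itv.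
  have defect : enorm (y (gridpoint T Nt m.+1) - y (gridpoint T Nt m)
      - dt *: f (gridpoint T Nt m.+1) (y (gridpoint T Nt m.+1))) <= K * dt ^+ 2.
    rewrite -y1E // -{1}tS -[in leRHS]tS; apply: taylor => //.
    - by rewrite -subr_gt0 tS.
    - by case/andP: tS0.
  have := imex_rb_step_error (ltW L_gt0) (ltW dt_gt0)
    (fun z w => f_lipschitz _ z w tSin) (fun z => f_le_M _ z tSin)
    (u_step m mNt) defect.
  move=> /le_trans; apply; rewrite lerD2l.
  have -> : B * dt ^+ 2 = K * dt ^+ 2 + dt * L * (dt * (K * T) + dt * M *+ 2).
    by rewrite /B; ring.
  rewrite lerD2l; apply: ler_wpM2l; first exact: mulr_ge0.
  by rewrite lerD2r expr2 mulrCA; do 2!rewrite ler_wpM2l //.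
have := discrete_gronwall _ _ e0 eS nNt.
rewrite -/(e n.+1) => /(_ _ _)/le_lt_trans; apply.
- by rewrite mulr_ge0 // ltW.
- by rewrite mulr_ge0 // sqr_ge0.
apply: (@le_lt_trans _ _ (T * B * expR (T * L) * dt)); last first.
  by rewrite ltr_pM2r // ltrDl.
have -> : n.+1%:R * (B * dt ^+ 2) * expR (n.+1%:R * (dt * L)) =
    n.+1%:R * dt * B * expR (n.+1%:R * (dt * L)) * dt by ring.
have ndt := grid_le n.+1 nNt.
rewrite ler_wpM2r // ler_pM ?mulr_ge0 ?expR_ge0 //.
  by rewrite ler_wpM2r.
by rewrite mulrA ler_expR ler_wpM2r.
Qed.
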